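(* Let $f:\mathbb{R}^d\to\mathbb{R}$ be twice continuously differentiable and bounded below, with gradient $g(x)=\nabla f(x)$ and Hessian $H(x)=\nabla^2 f(x)$. Assume: (i) there exists $0\le L_2<\infty$ such that for all $x\in\mathbb{R}^d$ and $t\ge0$, $\|H(x-t\,g(x))-H(x)\|\le t\,L_2\|g(x)\|$; (ii) there exists $0\le L_1<\infty$ such that for all $x\in\mathbb{R}^d$, if $\langle g(x),H(x)g(x)\rangle>0$ then $\|H(x)g(x)\|\le L_1\|g(x)\|$. Consider scaled gradient descent with line search (defined in the context), started at $x_0\in\mathbb{R}^d$ with termination tolerance $\varepsilon_g$. Then there is a constant $C$, independent of $\varepsilon_g$ (depending only on the problem and on the other algorithm parameters), such that for every $0<\varepsilon_g<1$ there is an integer $K\le C\varepsilon_g^{-2}$ (i.e. $K\in\mathcal{O}(\varepsilon_g^{-2})$) such that after at most $K$ iterations one has $\|g(x_k)\|\le\varepsilon_g$ for some $0\le k\le K$.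
   Context: Vector norms are Euclidean, matrix norms are spectral. Hessian-aware scaling selection: the inputs are a vector $g\in\mathbb{R}^d$, a symmetric matrix $H\in\mathbb{R}^{d\times d}$ and $\sigma>0$, with fixed constants $s^{\rm LPC}_{\min}\in(0,1/\sigma)$ and $0<s^{\rm NC}_{\min}\le s^{\rm NC}_{\max}<\infty$. It returns $p=-s\,g$ and a flag, where: (SPC) if $\langle g,Hg\rangle>\sigma\|g\|^2$, then $s$ is any one of $s^{\rm MR}=\frac{\langle g,Hg\rangle}{\|Hg\|^2}$, $s^{\rm CG}=\frac{\|g\|^2}{\langle g,Hg\rangle}$, $s^{\rm GM}=\frac{\|g\|}{\|Hg\|}$; (LPC) if $0\le\langle g,Hg\rangle\le\sigma\|g\|^2$, then $s$ is any number in $[s^{\rm LPC}_{\min},1/\sigma]$; (NC) if $\langle g,Hg\rangle<0$, then $s$ is any number in $[s^{\rm NC}_{\min},s^{\rm NC}_{\max}]$. Armijo condition at $x$ along $p$ with step size $\alpha$: $f(x+\alpha p)\le f(x)+\rho\,\alpha\,\langle p,g(x)\rangle$, where $\rho\in(0,1/2)$ is fixed. Backtracking line search (parameter $\theta\in(0,1)$, initial step $\alpha^0$): set $\alpha=\alpha^0$; while the Armijo condition fails replace $\alpha$ by $\theta\alpha$; return $\alpha$. Forward/backward tracking line search: set $\alpha=\alpha^0$; if the Armijo condition fails at $\alpha$, run backtracking; otherwise, while the Armijo condition holds at $\alpha$ replace $\alpha$ by $\alpha/\theta$, and finally return $\theta\alpha$. Scaled gradient descent with line search: given $\rho\in(0,1/2)$,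 $\varepsilon_g>0$, $x_0$, for $k=0,1,2,\dots$ and while $\|g(x_k)\|\ge\varepsilon_g$: obtain $p_k$ and the flag from the scaling selection with inputs $g(x_k)$, $H(x_k)$, $\sigma$; if the flag is SPC or LPC choose $\alpha_k\in(0,1]$ by backtracking with $\alpha^0=1$; if the flag is NC choose $\alpha_k\in(0,\infty)$ by forward/backward tracking with $\alpha^0=1$; set $x_{k+1}=x_k+\alpha_kp_k$. *)

(* Defs.v *)
From HB Require Import structures.
From mathcomp Require Import all_boot all_order all_algebra.
From mathcomp Require Import all_classical all_reals all_analysis.

Set Implicit Arguments.
Unset Strict Implicit.
Unset Printing Implicit Defensive.

Import Order.TTheory GRing.Theory Num.Theory.
Import numFieldNormedType.Exports.

Local Open Scope classical_set_scope.
Local Open Scope ring_scope.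

(* The library norm `|u| on matrices is the sup norm, hence the following
   Euclidean and spectral norms; both norms induce the same topology. *)

Definition dot (R : realType) (d : nat) (u v : 'cV[R]_d) : R :=
  \sum_(i < d) u i 0 * v i 0.

Definition eucl_norm (R : realType) (d : nat) (u : 'cV[R]_d) : R :=
  Num.sqrt (dot u u).

Definition spectral_norm (R : realType) (d : nat) (A : 'M[R]_d) : R :=
  sup [set eucl_norm (A *m v) | v in [set v : 'cV[R]_d | eucl_norm v <= 1]].

Definition grad (R : realType) (d : nat) (f : 'cV[R]_d -> R)
    (x : 'cV[R]_d) : 'cV[R]_d :=
  \col_(i < d) 'D_(delta_mx i 0) f x.

Definition hess (R : realType) (d : nat) (f : 'cV[R]_d -> R)
    (x : 'cV[R]_d) : 'M[R]_d :=
  \matrix_(i < d, j < d) 'D_(delta_mx j 0) (fun y => grad f y i 0) x.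

Definition twice_continuously_differentiable (R : realType) (d : nat)
    (f : 'cV[R]_d -> R) : Prop :=
  [/\ forall x, differentiable f x,
      forall x, differentiable (grad f) x
    & continuous (hess f)].

Inductive flag := SPC | LPC | NC.

(* [scaling_selection sigma sLPCmin sNCmin sNCmax g H fl p]: on inputs g, H the
   (nondeterministic) selection may return the direction p with flag fl. *)
Inductive scaling_selection (R : realType) (d : nat)
    (sigma sLPCmin sNCmin sNCmax : R) (g : 'cV[R]_d) (H : 'M[R]_d) :
    flag -> 'cV[R]_d -> Prop :=
| Select_MR of sigma * eucl_norm g ^+ 2 < dot g (H *m g) :
    scaling_selection sigma sLPCmin sNCmin sNCmax g H SPC
      (- (dot g (H *m g) / eucl_norm (H *m g) ^+ 2) *: g)
| Select_CG of sigma * eucl_norm g ^+ 2 < dot g (H *m g) :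
    scaling_selection sigma sLPCmin sNCmin sNCmax g H SPC
      (- (eucl_norm g ^+ 2 / dot g (H *m g)) *: g)
| Select_GM of sigma * eucl_norm g ^+ 2 < dot g (H *m g) :
    scaling_selection sigma sLPCmin sNCmin sNCmax g H SPC
      (- (eucl_norm g / eucl_norm (H *m g)) *: g)
| Select_LPC s of 0 <= dot g (H *m g) <= sigma * eucl_norm g ^+ 2
    & sLPCmin <= s <= 1 / sigma :
    scaling_selection sigma sLPCmin sNCmin sNCmax g H LPC (- s *: g)
| Select_NC s of dot g (H *m g) < 0 & sNCmin <= s <= sNCmax :
    scaling_selection sigma sLPCmin sNCmin sNCmax g H NC (- s *: g).

Definition armijo (R : realType) (d : nat) (f : 'cV[R]_d -> R) (rho : R)
    (x p : 'cV[R]_d) (a : R) : bool :=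
  f (x + a *: p) <= f x + rho * a * dot p (grad f x).

(* [while cond body a b]: the loop "while cond a, replace a by body a" started
   at a terminates with value b. *)
Inductive while (T : Type) (cond : T -> bool) (body : T -> T) : T -> T -> Prop :=
| While_stop a of ~~ cond a : while cond body a a
| While_step a b of cond a & while cond body (body a) b : while cond body a b.

(* [backtracking f rho theta x p a0 a] and [forward_backward ...]: the line
   search started at a0 terminates and returns a. *)
Definition backtracking (R : realType) (d : nat) (f : 'cV[R]_d -> R)
    (rho theta : R) (x p : 'cV[R]_d) (a0 a : R) : Prop :=
  while (fun b => ~~ armijo f rho x p b) (fun b => theta * b) a0 a.

Definition forward_backward (R : realType) (d : nat) (f : 'cV[R]_d -> R)
    (rho theta : R) (x p : 'cV[R]_d) (a0 a : R) : Prop :=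
  if ~~ armijo f rho x p a0 then backtracking f rho theta x p a0 a
  else exists2 b, while (armijo f rho x p) (fun b => b / theta) a0 b
                & a = theta * b.

Definition line_search (R : realType) (d : nat) (f : 'cV[R]_d -> R)
    (rho theta : R) (fl : flag) (x p : 'cV[R]_d) (a : R) : Prop :=
  match fl with
  | SPC | LPC => backtracking f rho theta x p 1 a
  | NC => forward_backward f rho theta x p 1 a
  end.

(* One pass through the body of the main loop. The outcome None means that the
   line search does not terminate, so that there is no next iterate. *)
Inductive sgd_step (R : realType) (d : nat) (f : 'cV[R]_d -> R)
    (sigma sLPCmin sNCmin sNCmax rho theta : R) (x : 'cV[R]_d) :
    option 'cV[R]_d -> Prop :=
| Step_next fl p a
    of scaling_selection sigma sLPCmin sNCmin sNCmax (grad f x) (hess f x) fl p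
    & line_search f rho theta fl x p a :
    sgd_step f sigma sLPCmin sNCmin sNCmax rho theta x (Some (x + a *: p))
| Step_diverges fl p
    of scaling_selection sigma sLPCmin sNCmin sNCmax (grad f x) (hess f x) fl p
    & (forall a, ~ line_search f rho theta fl x p a) :
    sgd_step f sigma sLPCmin sNCmin sNCmax rho theta x None.

(* [X k = Some x_k] is the k-th iterate of an execution. After normal
   termination the sequence repeats the final iterate; after a non-terminating
   line search it is None. *)
Definition sgd_run (R : realType) (d : nat) (f : 'cV[R]_d -> R)
    (sigma sLPCmin sNCmin sNCmax rho theta eps : R) (x0 : 'cV[R]_d)
    (X : nat -> option 'cV[R]_d) : Prop :=
  X 0%N = Some x0 /\
  forall k, match X k with
            | None => X k.+1 = None
            | Some x =>
                if eps <= eucl_norm (grad f x)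
                then sgd_step f sigma sLPCmin sNCmin sNCmax rho theta x (X k.+1)
                else X k.+1 = Some x
            end.

(* Main.v *)
Require Import Defs.
From HB Require Import structures.
From mathcomp Require Import all_boot all_order all_algebra.
From mathcomp Require Import all_classical all_reals all_analysis.
From mathcomp Require Import ring lra.

Set Implicit Arguments.
Unset Strict Implicit.
Unset Printing Implicit Defensive.

Import Order.TTheory GRing.Theory Num.Theory.
Import numFieldNormedType.Exports.

Local Open Scope classical_set_scope.
Local Open Scope ring_scope.

(** Along the ray from [x] in the direction [- grad f x] the Hessian varies at
    most linearly, so [f] lies below its second-order Taylor polynomial plus a
    cubic error term ([cubic_upper_bound]).  Write [G] for the gradient norm,
    [q] for the curvature [dot g (H *m g)] and [s] for the selected scaling.

    In each of the three curvature regimes [s] lies between two positive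
    constants and satisfies [s * q <= G ^+ 2] ([selection_scaling]): the
    scalings for strongly positive curvature are ordered MR <= GM <= CG by
    Cauchy-Schwarz, and CG times [q] is exactly [G ^+ 2].  Hence for [a <= 1]
    the quadratic term [a ^+ 2 * s ^+ 2 * q / 2] eats up at most half of the
    first-order decrease [a * s * G ^+ 2].  As [rho < 1 / 2], the Armijo
    condition follows once the cubic term is small, for which it is enough that
    [a * max 1 G <= c] with a constant [c] ([armijo_short_step]).

    Consequently the line search terminates and returns a step size that
    satisfies the Armijo condition and is at least [theta * c / max 1 G]
    ([line_search_terminates], [line_search_result]).  In the forward phase
    termination comes from the lower bound of [f], since acceptance of
    arbitrarily large steps would force [f] to minus infinity.

    So one iteration decreases [f] by at least
    [kappa * G ^+ 2 / max 1 G = kappa * min G (G ^+ 2)] ([sgd_step_decrease]),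
    which is at least [kappa * eps ^+ 2] as long as [G > eps] and [eps < 1].
    The gap between [f x0] and a lower bound of [f] then limits the number of
    iterations with gradient norm above [eps]. *)

(** * Euclidean and spectral norms *)

Section EuclideanNorm.
Variables (R : realType) (d : nat).
Implicit Types (u v w : 'cV[R]_d) (A : 'M[R]_d) (a : R).

Lemma dotC u v : dot u v = dot v u.
Proof. by apply: eq_bigr => i _; rewrite mulrC. Qed.

Lemma dotDl u v w : dot (u + v) w = dot u w + dot v w.
Proof. by rewrite -big_split; apply: eq_bigr => i _; rewrite mxE mulrDl. Qed.

Lemma dotZl a u v : dot (a *: u) v = a * dot u v.
Proof. by rewrite /dot mulr_sumr; apply: eq_bigr => i _; rewrite mxE mulrA. Qed.

Lemma dotDr u v w : dot u (v + w) = dot u v + dot u w.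
Proof. by rewrite dotC dotDl !(dotC _ u). Qed.

Lemma dotZr a u v : dot u (a *: v) = a * dot u v.
Proof. by rewrite dotC dotZl dotC. Qed.

Lemma dotNl u v : dot (- u) v = - dot u v.
Proof. by rewrite -(scaleN1r u) dotZl mulN1r. Qed.

Lemma dotNr u v : dot u (- v) = - dot u v.
Proof. by rewrite dotC dotNl dotC. Qed.

Lemma quad_formB A B v :
  dot (A *m v) v = dot v (B *m v) + dot v ((A - B) *m v).
Proof. by rewrite mulmxBl dotDr dotNr addrC subrK dotC. Qed.

Lemma quad_formN A v : dot (- v) (A *m - v) = dot v (A *m v).
Proof. by rewrite mulmxN dotNl dotNr opprK. Qed.

Lemma dot_ge0 u : 0 <= dot u u.
Proof. by apply: sumr_ge0 => i _; rewrite -expr2 sqr_ge0. Qed.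

Lemma eucl_norm_ge0 u : 0 <= eucl_norm u.
Proof. exact: sqrtr_ge0. Qed.

Lemma eucl_normN u : eucl_norm (- u) = eucl_norm u.
Proof. by rewrite /eucl_norm dotNl dotNr opprK. Qed.

Lemma eucl_norm_sqr u : eucl_norm u ^+ 2 = dot u u.
Proof. by rewrite sqr_sqrtr // dot_ge0. Qed.

Lemma eucl_normZ a u : 0 <= a -> eucl_norm (a *: u) = a * eucl_norm u.
Proof.
move=> a0; rewrite /eucl_norm dotZl dotZr mulrA sqrtrM ?mulr_ge0 //.
by rewrite -expr2 sqrtr_sqr ger0_norm.
Qed.

(** Cauchy-Schwarz, in squared form. *)
Lemma dot_sqr_le u v : dot u v ^+ 2 <= dot u u * dot v v.
Proof.
have [v0|v0] := eqVneq (dot v v) 0.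
  have vi0 i : v i 0 = 0.
    have /eqP := v0; rewrite psumr_eq0 => [/allP/(_ i)|j _].
      by rewrite mem_index_enum mulf_eq0 orbb => /(_ isT)/eqP.
    by rewrite -expr2 sqr_ge0.
  rewrite v0 mulr0 /dot big1 ?expr0n //= => i _.
  by rewrite vi0 mulr0.
have vgt0 : 0 < dot v v by rewrite lt_def v0 dot_ge0.
rewrite -(ler_pM2l vgt0) -subr_ge0.
(* w is dot v v times the component of u orthogonal to v *)
pose w := dot v v *: u + (- dot u v) *: v.
suff <- : dot w w = dot v v * (dot u u * dot v v) - dot v v * dot u v ^+ 2.
  exact: dot_ge0.
rewrite /w !(dotDl, dotDr, dotZl, dotZr) (dotC v u); ring.
Qed.

Lemma dot_le u v : dot u v <= eucl_norm u * eucl_norm v.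
Proof.
apply: le_trans (ler_norm _) _.
rewrite -ler_sqr ?nnegrE ?normr_ge0 ?mulr_ge0 ?eucl_norm_ge0 //.
by rewrite real_normK ?num_real // exprMn !eucl_norm_sqr dot_sqr_le.
Qed.

(** This is the Frobenius bound; it makes the supremum defining the spectral
    norm finite. *)
Lemma mulmx_bounded A :
  exists2 F : R, 0 <= F & forall v, eucl_norm (A *m v) <= F * eucl_norm v.
Proof.
pose r i : 'cV[R]_d := \col_j A i j.
have S0 : 0 <= \sum_i dot (r i) (r i) by apply: sumr_ge0 => i _; apply: dot_ge0.
exists (Num.sqrt (\sum_i dot (r i) (r i))); first exact: sqrtr_ge0.
move=> v; rewrite -sqrtrM //; apply: ler_wsqrtr.
rewrite mulr_suml; apply: ler_sum => i _.
have -> : (A *m v) i 0 = dot (r i) v.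
  by rewrite mxE; apply: eq_bigr => j _; rewrite mxE.
by rewrite -expr2 dot_sqr_le.
Qed.

(** Homogeneity reduces the bound to the unit ball over which the supremum is
    taken. *)
Lemma eucl_norm_mulmx A v :
  eucl_norm (A *m v) <= spectral_norm A * eucl_norm v.
Proof.
have [F F0 AF] := mulmx_bounded A.
have := eucl_norm_ge0 v; rewrite le_eqVlt => /orP[/eqP v0|v0].
  by rewrite -v0 mulr0 -[X in _ <= X](mulr0 F) v0.
rewrite -ler_pdivrMr //.
have -> : eucl_norm (A *m v) / eucl_norm v =
          eucl_norm (A *m ((eucl_norm v)^-1 *: v)).
  by rewrite -scalemxAr eucl_normZ ?invr_ge0 ?(ltW v0) // mulrC.
apply: ub_le_sup.
  exists F => _ [w /= w1 <-].
  by rewrite (le_trans (AF w)) // -[X in _ <= X]mulr1 ler_wpM2l.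
exists ((eucl_norm v)^-1 *: v) => //=.
by rewrite eucl_normZ ?invr_ge0 ?(ltW v0) // mulVf ?gt_eqF.
Qed.

End EuclideanNorm.

(** * Derivatives along a line *)

Section LineDerivative.
Variables (R : realType) (d : nat).
Implicit Types (h : 'cV[R]_d -> R) (f : 'cV[R]_d -> R) (x v g : 'cV[R]_d).

(** Differentiability makes the directional derivative linear in the direction,
    so it is determined by the partial derivatives collected in [grad]. *)
Lemma derive_grad h x v : differentiable h x -> 'D_v h x = dot (grad h x) v.
Proof.
move=> dh; rewrite deriveE //.
have {1}-> : v = \sum_i v i 0 *: delta_mx i 0.
  apply/colP => i; rewrite summxE (bigD1 i) //= big1 ?addr0.
    by rewrite !mxE !eqxx mulr1.
  by move=> j ji; rewrite !mxE eq_sym (negbTE ji) mulr0.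
rewrite raddf_sum; apply: eq_bigr => i _.
by rewrite [LHS]linearZ /= -deriveE // mxE mulrC.
Qed.

Lemma is_derive_line h x v (t : R) : differentiable h (x + t *: v) ->
  is_derive t 1 (fun s : R => h (x + s *: v)) (dot (grad h (x + t *: v)) v).
Proof.
move=> dh.
have dl : is_diff t (fun s : R => x + s *: v) ( *:%R ^~ v).
  have -> : (fun s : R => x + s *: v) = cst x + ( *:%R ^~ v) by [].
  apply: (is_diff_eq (is_diffD (is_diff_cst x t) (is_diff_scalel t v))).
  by rewrite add0r.
have dhl : is_diff t (h \o (fun s : R => x + s *: v))
    ('d h (x + t *: v) \o ( *:%R ^~ v)).
  by apply: is_diff_comp.
have dd : differentiable (fun s : R => h (x + s *: v)) t by case: dhl.
split; first exact/derivable1_diffP.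
rewrite deriveE //.
have -> : 'd (fun s : R => h (x + s *: v)) t =
    'd h (x + t *: v) \o ( *:%R ^~ v) :> (R -> R).
  by case: dhl.
by rewrite /= scale1r -derive_grad // deriveE.
Qed.

(** Row [i] of the Hessian is the gradient of the [i]-th partial derivative, so
    [is_derive_line] applies to each component. *)
Lemma is_derive_grad_line f x v w (t : R) :
  differentiable (grad f) (x + t *: v) ->
  is_derive t 1 (fun s : R => dot (grad f (x + s *: v)) w)
    (dot (hess f (x + t *: v) *m v) w).
Proof.
move=> dg.
pose fi i y := grad f y i 0.
have dfi i : differentiable (fi i) (x + t *: v).
  have -> : fi i = (fun N : 'cV[R]_d => N i 0) \o grad f by [].
  by apply: differentiable_comp => //; apply: differentiable_coord.
have -> : (fun s : R => dot (grad f (x + s *: v)) w) =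
    \sum_(i < d) (w i 0 *: (fun s : R => fi i (x + s *: v))).
  apply/funext => s; rewrite fct_sumE; apply: eq_bigr => i _.
  by rewrite mulrC.
have -> : dot (hess f (x + t *: v) *m v) w =
    \sum_(i < d) w i 0 *: dot (grad (fi i) (x + t *: v)) v.
  apply: eq_bigr => i _; rewrite mulrC; congr (_ * _).
  by rewrite mxE; apply: eq_bigr => j _; rewrite !mxE.
apply: is_derive_sum => i.
by apply: is_deriveZ; apply: is_derive_line.
Qed.

Lemma is_derive_nincr (F dF : R -> R) (t : R) :
  (forall s : R, is_derive s 1 F (dF s)) -> (forall s, 0 <= s -> dF s <= 0) ->
  0 <= t -> F t <= F 0.
Proof.
move=> dFE dF0 t0.
have cF : {within `[0, t], continuous F}.
  apply: continuous_subspaceT => s.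
  by apply/differentiable_continuous/derivable1_diffP; case: (dFE s).
have [c] := MVT_segment t0 (fun s _ => dFE s) cF.
rewrite in_itv /= => /andP[c0 _] E.
by rewrite -subr_le0 E mulr_le0_ge0 ?dF0 // subr0.
Qed.

End LineDerivative.

(** * Short steps satisfy the Armijo condition *)

(** Integrating the curvature bound once controls the slope along the line, and
    integrating again controls the function; both integrations are carried out
    by checking that the difference with the claimed bound is nonincreasing. *)
Lemma cubic_upper_bound (R : realType) (d : nat) (f : 'cV[R]_d -> R)
    (x v : 'cV[R]_d) (L t : R) :
  twice_continuously_differentiable f ->
  (forall s : R, 0 <= s ->
     spectral_norm (hess f (x + s *: v) - hess f x) <= s * L * eucl_norm v) ->
  0 <= t ->
  f (x + t *: v) <= f x + t * dot (grad f x) v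
    + t ^+ 2 / 2 * dot v (hess f x *m v) + t ^+ 3 / 6 * (L * eucl_norm v ^+ 3).
Proof.
move=> [df dg _] lipH; set q := dot v _; set M := L * _.
have hessE s : dot (hess f (x + s *: v) *m v) v =
    q + dot v ((hess f (x + s *: v) - hess f x) *m v).
  exact: quad_formB.
have curv s : 0 <= s -> dot (hess f (x + s *: v) *m v) v <= q + s * M.
  move=> s0; rewrite hessE lerD2l; apply: le_trans (dot_le _ _) _.
  have nv := eucl_norm_ge0 v.
  apply: (@le_trans _ _ (eucl_norm v * (s * L * eucl_norm v * eucl_norm v))).
    apply: ler_wpM2l => //; apply: le_trans (eucl_norm_mulmx _ _) _.
    by apply: ler_wpM2r => //; apply: lipH.
  by rewrite le_eqVlt /M; apply/orP; left; apply/eqP; ring.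
have slope s : 0 <= s -> dot (grad f (x + s *: v)) v <=
    dot (grad f x) v + s * q + s ^+ 2 / 2 * M.
  move=> s0; pose e (r : R) :=
    dot (grad f (x + r *: v)) v - r * q - r ^+ 2 * (M / 2).
  suff : e s <= e 0.
    rewrite /e scale0r addr0; move: (dot (grad f (x + s *: v)) v) => y; lra.
  apply: (@is_derive_nincr _ e
    (fun r => dot (hess f (x + r *: v) *m v) v - q - r * M)) => // r.
    have := is_derive_grad_line v (dg (x + r *: v)) => dgr.
    have -> : e = (fun r => dot (grad f (x + r *: v)) v)
        - (q *: (fun r : R => r)) - ((M / 2) *: ((fun r : R => r) ^+ 2)).
      by apply/funext => u; rewrite /e !fctE /= mulrC [_ ^+ 2 * _]mulrC.
    by apply: is_derive_eq; rewrite /GRing.scale /= /GRing.scale /=; field.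
  by move=> /curv; move: (dot _ v) => z; lra.
pose e (r : R) := f (x + r *: v) - r * dot (grad f x) v - r ^+ 2 * (q / 2)
   - r ^+ 3 * (M / 6).
move=> t0; suff : e t <= e 0.
  by rewrite /e scale0r addr0; lra.
apply: (@is_derive_nincr _ e
    (fun r => dot (grad f (x + r *: v)) v - dot (grad f x) v
              - r * q - r ^+ 2 / 2 * M)) => // r.
  have := is_derive_line (df (x + r *: v)) => dfr.
  have -> : e = (fun r => f (x + r *: v))
      - (dot (grad f x) v *: (fun r : R => r))
      - ((q / 2) *: ((fun r : R => r) ^+ 2))
      - ((M / 6) *: ((fun r : R => r) ^+ 3)).
    apply/funext => u; rewrite /e !fctE /=.
    by rewrite mulrC [_ ^+ 2 * _]mulrC [_ ^+ 3 * _]mulrC.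
  by apply: is_derive_eq; rewrite /GRing.scale /= /GRing.scale /=; field.
by move=> /slope; lra.
Qed.

(** The bound on [s * dot g (hess f x *m g)] together with [a <= 1] leaves at
    least half of the first-order decrease; the upper bounds on [c] keep the
    cubic term within the remaining margin [1 / 2 - rho].  A bound on [a] that
    is inversely proportional to the gradient norm, though the cubic term would
    allow its square root, avoids roots and does not change the order of the
    final rate. *)
Lemma armijo_short_step (R : realType) (d : nat) (f : 'cV[R]_d -> R)
    (x : 'cV[R]_d) (L rho s S c a : R) (g := grad f x) :
  twice_continuously_differentiable f ->
  (forall t : R, 0 <= t ->
     spectral_norm (hess f (x - t *: g) - hess f x) <= t * L * eucl_norm g) ->
  0 <= L -> 0 <= s <= S -> s * dot g (hess f x *m g) <= eucl_norm g ^+ 2 ->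
  0 <= c <= 1 -> c * (L * S ^+ 2) <= 3 - 6 * rho ->
  0 <= a -> a * Num.max 1 (eucl_norm g) <= c ->
  armijo f rho x (- s *: g) a.
Proof.
move=> C2 lip L0 /andP[s0 sS] sq /andP[c0 c1] cS a0 ac.
have lipN (t : R) : 0 <= t ->
    spectral_norm (hess f (x + t *: - g) - hess f x) <= t * L * eucl_norm (- g).
  by move=> t0; rewrite scalerN eucl_normN; apply: lip.
have := cubic_upper_bound C2 lipN (mulr_ge0 a0 s0); rewrite eucl_normN.
have -> : (a * s) *: - g = a *: (- s *: g).
  by rewrite scalerN scaleNr scalerN scalerA.
rewrite /armijo quad_formN dotNr dotZl -eucl_norm_sqr -/g.
move: (f (x + _)) (f x) sq => fa fx.
set q := dot _ _; set G := eucl_norm g in ac * => sq H; apply: le_trans H _.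
have G0 : 0 <= G by apply: eucl_norm_ge0.
have a1 : a <= c by apply: le_trans ac; rewrite ler_peMr // le_max lexx.
have aG : a * G <= c.
  by apply: le_trans ac; rewrite ler_wpM2l // le_max lexx orbT.
have k1 : (a ^+ 2 * s / 2) * (s * q) <= (a ^+ 2 * s / 2) * G ^+ 2.
  by apply: ler_wpM2l => //; rewrite !mulr_ge0 ?sqr_ge0.
have k2 : L * (a * G) * a * s ^+ 2 <= 3 - 6 * rho.
  apply: le_trans cS; apply: (@le_trans _ _ (L * c * 1 * S ^+ 2)); last lra.
  have s2 : s ^+ 2 <= S ^+ 2 by rewrite ler_sqr ?nnegrE ?(le_trans s0).
  apply: ler_pM => //; rewrite ?sqr_ge0 ?mulr_ge0 //.
  apply: ler_pM; rewrite ?mulr_ge0 //; first exact: ler_wpM2l.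
  exact: le_trans a1 c1.
(* the Armijo slack, with the curvature bound k1 used, as a product *)
have k3 : 0 <= (a * s * G ^+ 2) *
    (1 - rho - a / 2 - L * (a * G) * a * s ^+ 2 / 6).
  by rewrite mulr_ge0 ?mulr_ge0 ?sqr_ge0 //; lra.
rewrite -subr_ge0; apply: le_trans (_ : (a ^+ 2 * s / 2) * G ^+ 2
    - (a ^+ 2 * s / 2) * (s * q) + (a * s * G ^+ 2) *
    (1 - rho - a / 2 - L * (a * G) * a * s ^+ 2 / 6) <= _).
  by apply: addr_ge0 => //; rewrite subr_ge0.
by rewrite le_eqVlt; apply/orP; left; apply/eqP; field.
Qed.

(** * The selected scaling *)

(** Here [N] is the norm of the Hessian applied to the gradient and [q] the
    curvature, so the three quotients are the MR, GM and CG scalings; the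
    inequalities between them are Cauchy-Schwarz. *)
Lemma spc_scalings_bounds (R : realFieldType) (sigma L G N q : R) :
  0 < sigma -> 0 < G -> sigma * G ^+ 2 < q -> q <= G * N -> N <= L * G ->
  [/\ sigma / (1 + L ^+ 2) <= q / N ^+ 2, q / N ^+ 2 <= G / N,
      G / N <= G ^+ 2 / q & G ^+ 2 / q <= 1 / sigma].
Proof.
move=> sg0 G0 q0 CS NL.
have qpos : 0 < q by rewrite (lt_trans _ q0) ?mulr_gt0 ?exprn_gt0.
have N0 : 0 < N by have := lt_le_trans qpos CS; rewrite pmulr_rgt0.
have N2 : N ^+ 2 <= (L * G) ^+ 2.
  by rewrite ler_sqr ?nnegrE ?(ltW N0) // (le_trans (ltW N0)).
split.
- rewrite ler_pdivlMr ?exprn_gt0 // mulrAC ler_pdivrMr; last first.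
    by rewrite ltr_wpDr ?sqr_ge0.
  apply: (@le_trans _ _ (sigma * (L * G) ^+ 2)); first by rewrite ler_pM2l.
  apply: (@le_trans _ _ (sigma * G ^+ 2 * (1 + L ^+ 2))).
    by have := mulr_gt0 sg0 (exprn_gt0 2 G0); lra.
  by rewrite ler_wpM2r ?(ltW q0) // addr_ge0 ?sqr_ge0.
- by rewrite ler_pdivrMr ?exprn_gt0 // expr2 mulrA divfK ?gt_eqF.
- by rewrite ler_pdivlMr // mulrAC ler_pdivrMr // expr2 -mulrA ler_pM2l.
- by rewrite ler_pdivrMr // mulrAC mul1r ler_pdivlMr // mulrC ltW.
Qed.

(** The denominator [1 + L1 ^+ 2], instead of [L1 ^+ 2], keeps the lower bound
    positive when [L1 = 0]. *)
Lemma selection_scaling (R : realType) (d : nat)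
    (sigma sLPCmin sNCmin sNCmax L1 : R) (g p : 'cV[R]_d) (H : 'M[R]_d) fl :
  0 < sigma -> 0 < sLPCmin -> 0 < sNCmin -> 0 < eucl_norm g ->
  (0 < dot g (H *m g) -> eucl_norm (H *m g) <= L1 * eucl_norm g) ->
  scaling_selection sigma sLPCmin sNCmin sNCmax g H fl p ->
  exists s, [/\ p = - s *: g,
    Num.min (sigma / (1 + L1 ^+ 2)) (Num.min sLPCmin sNCmin) <= s,
    s <= Num.max (1 / sigma) sNCmax &
    s * dot g (H *m g) <= eucl_norm g ^+ 2].
Proof.
move=> sg0 lpc0 nc0 G0 HL sel.
pose m := Num.min (sigma / (1 + L1 ^+ 2)) (Num.min sLPCmin sNCmin).
have [m1 m2 m3] : [/\ m <= sigma / (1 + L1 ^+ 2), m <= sLPCmin & m <= sNCmin].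
  by rewrite /m !ge_min !lexx !orbT.
have [S1 S2] : 1 / sigma <= Num.max (1 / sigma) sNCmax /\
    sNCmax <= Num.max (1 / sigma) sNCmax by rewrite !le_max !lexx !orbT.
rewrite -/m.
case: sel => [q0|q0|q0|s /andP[q0 q1] /andP[s0 s1]|s q0 /andP[s0 s1]].
1-3: have qpos : 0 < dot g (H *m g)
  by (rewrite (lt_trans _ q0) ?mulr_gt0 ?exprn_gt0).
1-3: have [MRmin MRGM GMCG CGmax] :=
  spc_scalings_bounds sg0 G0 q0 (dot_le g (H *m g)) (HL qpos).
1-3: have CGq := divfK (lt0r_neq0 qpos) (eucl_norm g ^+ 2).
1-3: have {}MRmin := le_trans m1 MRmin; have {}CGmax := le_trans CGmax S1.
1-3: have MRCG := le_trans MRGM GMCG.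
- exists (dot g (H *m g) / eucl_norm (H *m g) ^+ 2); split=> //.
    exact: le_trans MRCG CGmax.
  by rewrite -CGq ler_pM2r.
- exists (eucl_norm g ^+ 2 / dot g (H *m g)); split=> //; last by rewrite CGq.
  exact: le_trans MRmin MRCG.
- exists (eucl_norm g / eucl_norm (H *m g)); split=> //.
  + exact: le_trans MRmin MRGM.
  + exact: le_trans GMCG CGmax.
  + by rewrite -CGq ler_pM2r.
- exists s; split=> //; [lra | exact: le_trans _ S1|].
  have := eucl_norm_ge0 g => G'.
  apply: (@le_trans _ _ (1 / sigma * (sigma * eucl_norm g ^+ 2))).
    by apply: ler_pM => //; lra.
  by rewrite mulrA divfK ?gt_eqF // mul1r.
- exists s; split=> //; [lra | exact: le_trans _ S2|].
  apply: le_trans (sqr_ge0 _); rewrite mulr_ge0_le0 ?ltW //; lra.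
Qed.

(** * Line search *)

Lemma whileP (T : Type) (cond : T -> bool) (body : T -> T) (I : T -> Prop) a b :
  while cond body a b -> I a ->
  (forall c, cond c -> I c -> I (body c)) -> I b /\ ~~ cond b.
Proof.
move=> w; elim: w => {a b} [a //|a b ca _ IH Ia st].
by apply: IH => //; apply: st.
Qed.

Lemma while_exits (T : Type) (cond : T -> bool) (body : T -> T) n a :
  ~~ cond (iter n body a) -> exists b, while cond body a b.
Proof.
elim: n a => [|n IH] a; first by exists a; apply: While_stop.
rewrite iterSr; case: (boolP (cond a)) => [ca /IH[b w]|nca _].
  by exists b; apply: While_step.
by exists a; apply: While_stop.
Qed.

Lemma iter_mulr (R : realType) (c a : R) n :
  iter n (fun b => c * b) a = c ^+ n * a.
Proof. by elim: n => [|n /= ->]; rewrite ?expr0 ?mul1r // exprS mulrA. Qed.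

Lemma iter_divr (R : realType) (c a : R) n :
  iter n (fun b => b / c) a = a / c ^+ n.
Proof.
by elim: n => [|n /= ->]; rewrite ?expr0 ?divr1 // exprSr invfM mulrA mulrAC.
Qed.

Lemma expr_small (R : realType) (theta e : R) :
  0 < theta < 1 -> 0 < e -> exists n, theta ^+ n < e.
Proof.
move=> /andP[t0 t1] e0.
have /cvgr0Pnorm_lt/(_ _ e0) : (GRing.exp theta : R ^nat) @ \oo --> 0.
  by apply: cvg_expr; rewrite gtr0_norm.
move=> [N _ /(_ N (leqnn N))] /=.
by rewrite gtr0_norm ?exprn_gt0 // => h; exists N.
Qed.

Section LineSearch.
Variables (R : realType) (d : nat) (f : 'cV[R]_d -> R) (rho theta tau : R).
Variables (x p : 'cV[R]_d).
Hypothesis theta_range : 0 < theta < 1.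
Hypothesis tau_range : 0 < tau <= 1.
Hypothesis armijo_short : forall a, 0 < a <= tau -> armijo f rho x p a.

(** A value below [tau] is never rejected, so each rejected value exceeds [tau]
    and its successor exceeds [theta * tau]. *)
Lemma backtracking_result a : backtracking f rho theta x p 1 a ->
  armijo f rho x p a /\ theta * tau <= a.
Proof.
have /andP[t0 t1] := theta_range; have /andP[tau0 tau1] := tau_range.
move=> bt.
suff [] : theta * tau <= a /\ ~~ ~~ armijo f rho x p a by rewrite negbK.
apply: (@whileP _ _ _ (fun b => theta * tau <= b) _ _ bt); first by nra.
move=> c nc ct; rewrite ler_pM2l // leNgt; apply: contra nc => ctau.
by apply: armijo_short; rewrite (ltW ctau) (lt_le_trans _ ct) // mulr_gt0.
Qed.

Lemma line_search_result fl a : line_search f rho theta fl x p a ->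
  armijo f rho x p a /\ theta * tau <= a.
Proof.
have /andP[t0 t1] := theta_range; have /andP[tau0 tau1] := tau_range.
case: fl; try exact: backtracking_result.
rewrite /line_search /forward_backward; case: ifPn => [_|/negbNE A1].
  exact: backtracking_result.
move=> [b w ->]; have tn0 : theta != 0 by rewrite gt_eqF.
(* every value of the forward loop but the initial one is 1 / theta times an
   accepted step size that is at least 1 *)
pose I b := b = 1 \/ armijo f rho x p (theta * b) /\ 1 <= theta * b.
have [] : I b /\ ~~ armijo f rho x p b.
  apply: (@whileP _ _ _ I _ _ w); first by left.
  move=> c Ac Ic; right; rewrite mulrC divfK //; split=> //.
  case: Ic => [-> //|[_ tc1]].
  have c0 : 0 < c.
    by rewrite -(pmulr_rgt0 c t0) (lt_le_trans ltr01).
  by rewrite (le_trans tc1) // ler_piMl // ltW.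
case=> [->|[Ab b1] _]; first by rewrite A1.
by split=> //; apply: le_trans b1; nra.
Qed.

(** Backtracking stops when it enters the range [a <= tau].  Forward tracking
    stops because acceptance of [theta ^- n] bounds [f] by
    [f x + rho * theta ^- n * dot p (grad f x)], which eventually drops below
    any given lower bound. *)
Lemma line_search_terminates fl : 0 < rho -> has_lbound (range f) ->
  dot p (grad f x) < 0 -> exists a, line_search f rho theta fl x p a.
Proof.
have /andP[t0 t1] := theta_range; have /andP[tau0 tau1] := tau_range.
move=> rho0 [m fm] desc.
have bt : exists a, backtracking f rho theta x p 1 a.
  have [n hn] := expr_small theta_range tau0.
  apply: (@while_exits _ _ _ n); rewrite iter_mulr mulr1 negbK.
  by apply: armijo_short; rewrite exprn_gt0 // ltW.
case: fl; [exact: bt | exact: bt | rewrite /line_search /forward_backward].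
case: (~~ armijo f rho x p 1); first exact: bt.
suff [b w] : exists b, while (armijo f rho x p) (fun b => b / theta) 1 b.
  by exists (theta * b); exists b.
pose D := rho * - dot p (grad f x).
have D0 : 0 < D by rewrite mulr_gt0 // oppr_gt0.
have F0 : 0 < f x - m + 1.
  by rewrite ltr_wpDl // subr_ge0; apply: fm; exists x.
have [n hn] := expr_small theta_range (divr_gt0 D0 F0).
apply: (@while_exits _ _ _ n); rewrite iter_divr /armijo -ltNge.
have : m <= f (x + 1 / theta ^+ n *: p) by apply: fm; eexists.
apply: lt_le_trans.
have : f x - m + 1 < D / theta ^+ n.
  by move: hn; rewrite ltr_pdivlMr // ltr_pdivlMr ?exprn_gt0 // mulrC.
by rewrite /D => h; lra.
Qed.

End LineSearch.

(** * Decrease per iteration and complexity *)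

(** The outcome [Some y] also records that the line search terminates.  The
    minimum arises from [G ^+ 2 / max 1 G]. *)
Lemma sgd_step_decrease (R : realType) (d : nat) (f : 'cV[R]_d -> R)
    (L1 L2 sigma sLPCmin sNCmin sNCmax rho theta : R) :
  twice_continuously_differentiable f ->
  has_lbound (range f) ->
  0 <= L2 ->
  (forall (x : 'cV[R]_d) (t : R), 0 <= t ->
     spectral_norm (hess f (x - t *: grad f x) - hess f x)
       <= t * L2 * eucl_norm (grad f x)) ->
  (forall x : 'cV[R]_d, 0 < dot (grad f x) (hess f x *m grad f x) ->
     eucl_norm (hess f x *m grad f x) <= L1 * eucl_norm (grad f x)) ->
  0 < sigma -> 0 < sLPCmin -> 0 < sNCmin -> 0 < rho < 1 / 2 -> 0 < theta < 1 ->
  exists2 kappa : R, 0 < kappa & forall x o,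
    0 < eucl_norm (grad f x) ->
    sgd_step f sigma sLPCmin sNCmin sNCmax rho theta x o ->
    exists2 y, o = Some y &
      f y <= f x - kappa *
        Num.min (eucl_norm (grad f x)) (eucl_norm (grad f x) ^+ 2).
Proof.
move=> C2 fb L20 lip HL sg0 lpc0 nc0 /andP[rho0 rho1] thr.
have /andP[th0 th1] := thr.
pose m := Num.min (sigma / (1 + L1 ^+ 2)) (Num.min sLPCmin sNCmin).
pose S := Num.max (1 / sigma) sNCmax.
have m0 : 0 < m.
  rewrite /m !lt_min lpc0 nc0 !andbT divr_gt0 //.
  by rewrite ltr_wpDr ?sqr_ge0.
have B0 : 0 <= L2 * S ^+ 2 by rewrite mulr_ge0 ?sqr_ge0.
pose c := Num.min 1 ((3 - 6 * rho) / (1 + L2 * S ^+ 2)).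
have c0 : 0 < c by rewrite lt_min ltr01 divr_gt0 //; lra.
have c1 : c <= 1 by rewrite ge_min lexx.
have cS : c * (L2 * S ^+ 2) <= 3 - 6 * rho.
  have : c <= (3 - 6 * rho) / (1 + L2 * S ^+ 2) by rewrite ge_min lexx orbT.
  by rewrite ler_pdivlMr; lra.
exists (rho * m * theta * c) => [|x o G0 st]; first by rewrite !mulr_gt0.
set G := eucl_norm (grad f x) in G0 *.
set M := Num.max 1 G.
have M1 : 1 <= M by rewrite le_max lexx.
have M0 : 0 < M by apply: lt_le_trans M1.
have taur : 0 < c / M <= 1.
  by rewrite divr_gt0 //= ler_pdivrMr // mul1r (le_trans c1).
have short fl p :
    scaling_selection sigma sLPCmin sNCmin sNCmax (grad f x) (hess f x) fl p ->
    exists s, [/\ p = - s *: grad f x, m <= s &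
      forall a, 0 < a <= c / M -> armijo f rho x p a].
  move=> /(selection_scaling sg0 lpc0 nc0 G0 (HL x)) [s [-> ms sS sq]].
  exists s; split=> // a /andP[a0 aM].
  apply: (@armijo_short_step _ _ _ _ L2 rho s S c a C2 (lip x)) => //.
  - by rewrite (le_trans (ltW m0)).
  - by rewrite (ltW c0).
  - exact: ltW.
  - by rewrite -ler_pdivlMr.
case: st => [fl p a sel ls|fl p sel ls]; have [s [pE ms sh]] := short _ _ sel.
  exists (x + a *: p) => //.
  have [A aM] := line_search_result thr taur sh ls.
  apply: le_trans A _.
  rewrite pE dotZl -eucl_norm_sqr -/G.
  have minE : Num.min G (G ^+ 2) * M <= G ^+ 2.
    rewrite /M; case: (leP 1 G) => G1.
      rewrite [G ^+ 2 in leRHS]expr2 ler_wpM2r ?(ltW G0) //.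
      by rewrite ge_min lexx.
    by rewrite mulr1 ge_min lexx orbT.
  have mn0 : 0 <= Num.min G (G ^+ 2) by rewrite le_min !ltW ?exprn_gt0.
  have h1 : theta * c * Num.min G (G ^+ 2) <= a * G ^+ 2.
    apply: (@le_trans _ _ (theta * (c / M) * G ^+ 2)).
      rewrite -!mulrA ler_pM2l // ler_pM2l //.
      by rewrite mulrC ler_pdivlMr.
    by rewrite ler_pM2r ?exprn_gt0.
  have h2 : m * (theta * c * Num.min G (G ^+ 2)) <= s * (a * G ^+ 2).
    by apply: ler_pM => //; [exact: ltW | rewrite !mulr_ge0 // ltW].
  have := ler_wpM2l (ltW rho0) h2.
  by move: (Num.min _ _) (f x) => mn fx; lra.
have [|a] := @line_search_terminates _ _ f rho theta _ x p thr taur sh fl rho0 fb.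
  rewrite pE dotZl -eucl_norm_sqr mulNr oppr_lt0 mulr_gt0 ?exprn_gt0 //.
  exact: lt_le_trans ms.
by move=> /ls.
Qed.

Lemma sgd_run_progress (R : realType) (d : nat) (f : 'cV[R]_d -> R)
    (sigma sLPCmin sNCmin sNCmax rho theta eps delta : R) (x0 : 'cV[R]_d) X :
  (forall x o, eps < eucl_norm (grad f x) ->
     sgd_step f sigma sLPCmin sNCmin sNCmax rho theta x o ->
     exists2 y, o = Some y & f y <= f x - delta) ->
  sgd_run f sigma sLPCmin sNCmin sNCmax rho theta eps x0 X ->
  forall n,
    (exists k x, [/\ (k <= n)%N, X k = Some x & eucl_norm (grad f x) <= eps])
    \/ exists2 x, X n = Some x & f x <= f x0 - n%:R * delta.
Proof.
move=> dec [X0 Xstep]; elim=> [|n [[k [x [kn Xk xe]]]|[x Xn fx]]].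
- by right; exists x0; rewrite // mul0r subr0.
- by left; exists k, x; split=> //; apply: leqW.
have [xe|ex] := leP (eucl_norm (grad f x)) eps.
  by left; exists n, x; split.
have := Xstep n; rewrite Xn (ltW ex) => /(dec _ _ ex)[y -> fy].
right; exists y => //; apply: le_trans fy _.
by rewrite -natr1 mulrDl mul1r; lra.
Qed.

Theorem proposition3p6 (R : realType) (d : nat) (f : 'cV[R]_d -> R)
    (L1 L2 sigma sLPCmin sNCmin sNCmax rho theta : R) (x0 : 'cV[R]_d)
    (f_C2 : twice_continuously_differentiable f)
    (f_bounded_below : has_lbound (range f))
    (L2_ge0 : 0 <= L2)
    (hess_lipschitz : forall (x : 'cV[R]_d) (t : R), 0 <= t ->
       spectral_norm (hess f (x - t *: grad f x) - hess f x)
         <= t * L2 * eucl_norm (grad f x))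
    (L1_ge0 : 0 <= L1)
    (hess_grad_bound : forall x : 'cV[R]_d,
       0 < dot (grad f x) (hess f x *m grad f x) ->
       eucl_norm (hess f x *m grad f x) <= L1 * eucl_norm (grad f x))
    (sigma_gt0 : 0 < sigma)
    (sLPCmin_range : 0 < sLPCmin < 1 / sigma)
    (sNCmin_gt0 : 0 < sNCmin)
    (sNCmin_le_max : sNCmin <= sNCmax)
    (rho_range : 0 < rho < 1 / 2)
    (theta_range : 0 < theta < 1) :
  exists C : R, forall eps : R, 0 < eps < 1 ->
    exists2 K : nat, K%:R <= C * eps ^- 2 &
      forall X : nat -> option 'cV[R]_d,
        sgd_run f sigma sLPCmin sNCmin sNCmax rho theta eps x0 X ->
        exists k : nat, exists x : 'cV[R]_d,
          [/\ (k <= K)%N, X k = Some x & eucl_norm (grad f x) <= eps].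
Proof.
have /andP[lpc0 _] := sLPCmin_range.
have [kappa kappa0 step] := @sgd_step_decrease R d f L1 L2 sigma sLPCmin sNCmin
  sNCmax rho theta f_C2 f_bounded_below L2_ge0 hess_lipschitz hess_grad_bound
  sigma_gt0 lpc0 sNCmin_gt0 rho_range theta_range.
have [m fm] := f_bounded_below.
have Delta0 : 0 <= f x0 - m by rewrite subr_ge0; apply: fm; exists x0.
(* the summand 1 absorbs the rounding up of K, since eps ^- 2 > 1 *)
exists ((f x0 - m) / kappa + 1) => eps /andP[e0 e1].
have e20 : 0 < eps ^+ 2 by rewrite exprn_gt0.
pose q := (f x0 - m) / kappa * eps ^- 2.
have q0 : 0 <= q.
  by rewrite mulr_ge0 ?divr_ge0 ?invr_ge0 ?(ltW kappa0) ?(ltW e20).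
exists (Num.truncn q).+1.
  rewrite -natr1 mulrDl mul1r lerD //; first by rewrite truncn_le.
  by rewrite invf_ge1 // expr_le1 // ltW.
move=> X run.
have dec x o : eps < eucl_norm (grad f x) ->
    sgd_step f sigma sLPCmin sNCmin sNCmax rho theta x o ->
    exists2 y, o = Some y & f y <= f x - kappa * eps ^+ 2.
  move=> ex /(step _ _ (lt_trans e0 ex))[y -> fy]; exists y => //.
  apply: le_trans fy _; rewrite lerD2l lerN2 ler_pM2l //.
  have ee : eps ^+ 2 <= eps by rewrite expr2 ler_piMr // ltW.
  rewrite le_min (le_trans ee (ltW ex)) /=.
  by rewrite ler_sqr ?nnegrE ?(ltW e0) ?eucl_norm_ge0 // ltW.
have [//|[x _ fx]] := sgd_run_progress dec run (Num.truncn q).+1.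
(* K = truncn q + 1 strictly exceeds q, so K decreases of kappa * eps ^+ 2
   would bring f below its lower bound m *)
have mx : m <= f x by apply: fm; exists x.
have qK := truncnS_gt q.
have : f x0 - m < (Num.truncn q).+1%:R * (kappa * eps ^+ 2).
  by move: qK; rewrite /q !ltr_pdivrMr // -mulrA [eps ^+ 2 * _]mulrC.
lra.
Qed.
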